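(* Over any field of characteristic different from 2, the family $(f_k)$ with $f_k=f_{G_k,H_k}(\bar Y)$, where $G_k$ is the simple undirected cycle of length $2k+1$ and $H_k$ is the undirected complete graph on $(2k+1)^2$ vertices, is complete for $\mathsf{VBP}$ under $p$-projections.
   Context: For graphs $G,H$, a homomorphism $G\to H$ is a vertex map preserving edges. With a variable $Y_{(a,b)}$ for each edge $(a,b)\in E(H)$, the homomorphism polynomial is $f_{G,H}(\bar Y)=\sum_{\phi}\prod_{(u,v)\in E(G)}Y_{(\phi(u),\phi(v))}$, the sum over all homomorphisms $\phi:G\to H$. $\mathsf{VBP}$ is the class of $p$-families (polynomially bounded number of variables and degree) computed by polynomial-size skew arithmetic circuits (at each $\times$ gate at most one input is the output of another gate). A projection of $g$ substitutes field constants or variables for the variables of $g$; $(f_n)$ is a $p$-projection of $(g_m)$ if each $f_n$ is a projection of $g_{t(n)}$ with $t$ polynomially bounded. Complete for $\mathsf{VBP}$ under $p$-projections means the family is in $\mathsf{VBP}$ and every family in $\mathsf{VBP}$ is a $p$-projection of it. *)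

(* Defs.v *)
From HB Require Import structures.
From mathcomp Require Import all_boot all_algebra.
From mathcomp Require Export mpoly.
Set Implicit Arguments. Unset Strict Implicit. Unset Printing Implicit Defensive.
Import GRing.Theory.
Local Open Scope ring_scope.

Definition pbounded (t : nat -> nat) : Prop :=
  exists c : nat, forall n : nat, (t n <= (n + 2) ^ c)%N.

(* A circuit is a list of gates (each an addition or multiplication of *)
(* two operands) and an output operand.  An operand is an input leaf   *)
(* (a variable or a field constant) or the output of an earlier gate   *)
(* (referenced by its position in the list; a reference to a gate that *)
(* is not earlier evaluates to 0).                                     *)
Section Circuits.
Variables (F : fieldType) (n : nat).

Inductive operand : Type :=
  | OVar of 'I_n
  | OConst of F
  | OGate of nat.

Inductive gate : Type :=
  | GAdd of operand & operand
  | GMul of operand & operand.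

Record circuit : Type := Circuit { gates : seq gate ; output : operand }.

Definition eval_operand (vals : seq {mpoly F[n]}) (o : operand) : {mpoly F[n]} :=
  match o with
  | OVar i => 'X_i
  | OConst c => c%:MP
  | OGate j => nth 0 vals j
  end.

Definition eval_gate (vals : seq {mpoly F[n]}) (g : gate) : {mpoly F[n]} :=
  match g with
  | GAdd a b => eval_operand vals a + eval_operand vals b
  | GMul a b => eval_operand vals a * eval_operand vals b
  end.

Definition gate_values (gs : seq gate) : seq {mpoly F[n]} :=
  foldl (fun vals g => rcons vals (eval_gate vals g)) [::] gs.

Definition circuit_poly (C : circuit) : {mpoly F[n]} :=
  eval_operand (gate_values (gates C)) (output C).

(* size = number of gates (+1 for the output node) *)
Definition circuit_size (C : circuit) : nat := (size (gates C)).+1.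

Definition is_leaf (o : operand) : bool :=
  match o with OGate _ => false | _ => true end.

Definition skew_gate (g : gate) : bool :=
  match g with
  | GAdd _ _ => true
  | GMul a b => is_leaf a || is_leaf b
  end.

Definition skew (C : circuit) : bool := all skew_gate (gates C).

End Circuits.

Section Complexity.
Variable F : fieldType.

Definition p_family (v : nat -> nat) (f : forall n, {mpoly F[v n]}) : Prop :=
  pbounded v /\ pbounded (fun n => msize (f n)).

Definition in_VBP (v : nat -> nat) (f : forall n, {mpoly F[v n]}) : Prop :=
  p_family f /\
  exists s : nat -> nat, pbounded s /\
    forall n, exists C : circuit F (v n),
      skew C /\ (circuit_size C <= s n)%N /\ circuit_poly C = f n.

Definition projection_of (k m : nat) (f : {mpoly F[k]}) (g : {mpoly F[m]}) : Prop :=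
  exists s : m.-tuple {mpoly F[k]},
    (forall i : 'I_m, (exists c : F, tnth s i = c%:MP) \/
                      (exists j : 'I_k, tnth s i = 'X_j)) /\
    f = g \mPo s.

Definition p_projection (v : nat -> nat) (f : forall n, {mpoly F[v n]})
    (w : nat -> nat) (g : forall m, {mpoly F[w m]}) : Prop :=
  exists t : nat -> nat, pbounded t /\
    forall n, projection_of (f n) (g (t n)).

Definition VBP_complete (w : nat -> nat) (g : forall m, {mpoly F[w m]}) : Prop :=
  in_VBP g /\
  forall (v : nat -> nat) (f : forall n, {mpoly F[v n]}),
    in_VBP f -> p_projection f g.

End Complexity.

(* Simple undirected graphs on a finType: symmetric irreflexive rels.  *)
Section Hom.
Variables (F : fieldType) (V W : finType) (adjG : rel V) (adjH : rel W).

Definition edges (T : finType) (adj : rel T) : {set {set T}} :=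
  [set e : {set T} | [exists u, exists v, adj u v && (e == [set u; v])]].

Definition edgeH : Type := {e : {set W} | e \in edges adjH}.
Definition nvars : nat := #|{: edgeH}|.

Definition Yvar (e : {set W}) : {mpoly F[nvars]} :=
  match (insub e : option edgeH) with
  | Some e' => 'X_(enum_rank e')
  | None => 0
  end.

Definition is_hom (phi : {ffun V -> W}) : bool :=
  [forall u, forall v, adjG u v ==> adjH (phi u) (phi v)].

Definition hom_poly : {mpoly F[nvars]} :=
  \sum_(phi : {ffun V -> W} | is_hom phi) \prod_(e in edges adjG) Yvar (phi @: e).

End Hom.

(* the simple undirected cycle on 'I_m (m >= 3) *)
Definition cycle_adj (m : nat) : rel 'I_m :=
  fun i j => (i != j) &&
    ((val j == (val i).+1 %% m)%N || (val i == (val j).+1 %% m)%N).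

Definition complete_adj (N : nat) : rel 'I_N := fun a b => a != b.

(* the family of the theorem, indexed by n with k = n + 1 (k >= 1)     *)
Definition cyc_len (n : nat) : nat := (2 * n.+1).+1.
Definition compl_size (n : nat) : nat := (cyc_len n ^ 2)%N.

Definition fk_vars (n : nat) : nat := nvars (@complete_adj (compl_size n)).

Definition fk (F : fieldType) (n : nat) : {mpoly F[fk_vars n]} :=
  hom_poly F (@cycle_adj (cyc_len n)) (@complete_adj (compl_size n)).

(* Main.v *)
Require Import Defs.
From mathcomp Require Import all_boot all_algebra zify.
From mathcomp Require Import mpoly.
Set Implicit Arguments. Unset Strict Implicit. Unset Printing Implicit Defensive.
Import GRing.Theory.
Local Open Scope ring_scope.

(* Write L = 2k + 1.  Since Y vanishes on loops, f_k is the sum over all closed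
   walks of length L in the complete graph, i.e. the trace of the L-th power of
   a symmetric matrix of variables, which iterated matrix-vector products
   compute by a skew circuit.

   For hardness, a skew circuit is a program of register updates
   R_d := R_d + c * R_e with c a variable or a constant, i.e. a product of
   matrices 1 + c E_(e,d).  Arrange the L^2 vertices in L cyclic layers of L
   vertices and put the j-th matrix between layers j and j + 1.  A closed walk
   of odd length L moves by +1 or -1 among the layers at each step, so it has to
   wind exactly once around, in one of 2 directions and from one of L starting
   layers: the projected polynomial is 2L times the trace of the product of the
   matrices, and the factor 2L is cancelled by a constant in the last one.  As
   the characteristic is not 2, it does not divide both L and L + 2, so that L
   can be chosen with 2L invertible. *)

(** * Sums over paths and closed walks as entries and traces of matrix products *)

Section Walks.
Variables (R : comNzRingType) (W : finType).
Implicit Types (M : nat -> W -> W -> R) (a b : W).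

(** Entry (a, b) of the matrix product M 0 * M 1 * ... * M (t - 1). *)
Fixpoint walk M a t b : R :=
  if t is t'.+1 then \sum_c walk M a t' c * M t' c b else (a == b)%:R.

Definition ffun_rcons n (g : {ffun 'I_n -> W}) w : {ffun 'I_n.+1 -> W} :=
  [ffun i => if unlift ord_max i is Some j then g j else w].

Lemma ffun_rcons_lt n (g : {ffun 'I_n.+1 -> W}) w i :
  (i <= n)%N -> ffun_rcons g w (inord i) = g (inord i).
Proof.
move=> le_in; rewrite ffunE.
have -> : inord i = lift ord_max (inord i : 'I_n.+1) :> 'I_n.+2.
  by apply: val_inj; rewrite /= /bump !inordK //; lia.
by rewrite liftK.
Qed.

Lemma ffun_rcons_max n (g : {ffun 'I_n -> W}) w :
  ffun_rcons g w (inord n) = w.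
Proof.
rewrite ffunE (_ : inord n = ord_max) ?unlift_none //.
by apply: val_inj; rewrite /= inordK.
Qed.

Lemma sum_ffun_rcons n (G : {ffun 'I_n.+1 -> W} -> R) :
  \sum_f G f = \sum_g \sum_w G (ffun_rcons g w).
Proof.
rewrite pair_big /= (reindex (fun p => ffun_rcons p.1 p.2)) //=.
exists (fun f : {ffun 'I_n.+1 -> W} => ([ffun j => f (lift ord_max j)], f ord_max)).
  move=> [g w] _; congr pair; last by rewrite ffunE unlift_none.
  by apply/ffunP => j; rewrite !ffunE liftK.
move=> f _; apply/ffunP => i; rewrite ffunE /=.
by case: unliftP => [j|] ->; rewrite ?ffunE.
Qed.

(** Induction on t peels off the last vertex. The end weight G is arbitrary so that it can absorb
    the peeled factor, and so that [sum_cycles] can take it to be the closing edge. *)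
Lemma sum_paths M t (G : W -> W -> R) :
  \sum_(f : {ffun 'I_t.+1 -> W})
     (\prod_(i < t) M i (f (inord i)) (f (inord i.+1))) *
     G (f (inord 0)) (f (inord t))
  = \sum_a \sum_b walk M a t b * G a b.
Proof.
elim: t G => [|t IHt] G.
  transitivity (\sum_w G w w).
    rewrite (reindex (fun w : W => [ffun _ : 'I_1 => w])) /=.
      by apply: eq_bigr => w _; rewrite big_ord0 mul1r !ffunE.
    exists (fun f => f ord0) => [w _ | f _]; first by rewrite ffunE.
    by apply/ffunP => i; rewrite ffunE (ord1 i).
  apply: eq_bigr => a _; rewrite (bigD1 a) //= eqxx mul1r big1 ?addr0 // => b.
  by rewrite eq_sym => /negPf ->; rewrite mul0r.
rewrite sum_ffun_rcons.
transitivity (\sum_(g : {ffun 'I_t.+1 -> W})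
   (\prod_(i < t) M i (g (inord i)) (g (inord i.+1))) *
     (\sum_w M t (g (inord t)) w * G (g (inord 0)) w)).
  apply: eq_bigr => g _; rewrite mulr_sumr; apply: eq_bigr => w _.
  rewrite big_ord_recr /= ffun_rcons_max !ffun_rcons_lt // mulrA.
  congr (_ * _ * _); apply: eq_bigr => i _.
  by rewrite !ffun_rcons_lt //; have := ltn_ord i; lia.
rewrite (IHt (fun a b => \sum_w M t b w * G a w)); apply: eq_bigr => a _.
transitivity (\sum_b \sum_w walk M a t b * M t b w * G a w).
  by apply: eq_bigr => b _; rewrite mulr_sumr; apply: eq_bigr => w _; rewrite mulrA.
rewrite exchange_big /=; apply: eq_bigr => w _.
by rewrite mulr_suml.
Qed.

Lemma sum_cycles M L :
  \sum_(f : {ffun 'I_L.+1 -> W}) \prod_(i < L.+1) M i (f i) (f (ordS i))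
  = \sum_a walk M a L.+1 a.
Proof.
rewrite -[RHS]/(\sum_a \sum_c walk M a L c * M L c a).
rewrite -(sum_paths M L (fun a b => M L b a)).
apply: eq_bigr => f _; rewrite big_ord_recr /=; congr (_ * _).
  apply: eq_bigr => i _; congr (M _ (f _) (f _)).
    by apply: val_inj; rewrite /= inordK //; have := ltn_ord i; lia.
  by apply: val_inj; rewrite /= inordK ?modn_small ?ltnS.
congr (M _ (f _) (f _)).
  by apply: val_inj; rewrite /= inordK.
by apply: val_inj; rewrite /= inordK // modnn.
Qed.

End Walks.

(** * Closed walks of odd length through cyclically arranged layers *)

Section LayeredCycle.
Variables (q : nat) (R : comNzRingType).
Local Notation L := q.+3.
Local Notation vmap := {ffun 'I_L -> 'I_L * 'I_L}.
Hypothesis oddL : odd L.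

Lemma Zp_step_succ (l : 'I_L -> 'I_L) :
  (forall i, l (i + 1) = l i + 1) -> forall i j, l (i + j) = l i + j.
Proof.
move=> lS i j; rewrite -[j]natr_Zp.
elim: (val j) => [|n IHn]; first by rewrite !addr0.
by rewrite -natr1 !addrA lS IHn.
Qed.

(* The steps sum to 0 in Z/L; with k steps +1 and L - k steps -1 this reads
   2k = 0 mod L, and L is odd. *)
Lemma closed_walk_oriented (l : 'I_L -> 'I_L) :
  (forall i, l (i + 1) = l i + 1 \/ l i = l (i + 1) + 1) ->
  (forall i, l (i + 1) = l i + 1) \/ (forall i, l i = l (i + 1) + 1).
Proof.
move=> step; pose P i := l (i + 1) == l i + 1.
have sum0 : \sum_i (l (i + 1) - l i) = 0.
  rewrite sumrB [X in _ - X](reindex_inj (@addIr _ (1 : 'I_L))) /=.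
  exact: subrr.
have sumP : \sum_i (l (i + 1) - l i) = (2 * #|P|)%:R.
  transitivity (\sum_i ((P i)%:R *+ 2 - 1 : 'I_L)).
    apply: eq_bigr => i _; rewrite /P; case: eqP => [->|neq].
      by rewrite addrAC subrr add0r mulr2n addrK.
    by case: (step i) => // ->; rewrite opprD addrA subrr mul0rn.
  rewrite sumrB sumr_const card_ord sumrMnl -natr_sum.
  have -> : (\sum_i P i = #|P|)%N by rewrite -sum1_card [RHS]big_mkcond.
  have -> : 1 *+ L = 0 :> 'I_L by apply: val_inj; rewrite Zp_nat /= modnn.
  by rewrite subr0 mulnC natrM mulr_natr.
have dvd : (L %| #|P|)%N.
  have : (2 * #|P|)%:R = 0 :> 'I_L by rewrite -sumP.
  move/(congr1 val); rewrite Zp_nat /= => /eqP.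
  by rewrite -/(dvdn _ _) Gauss_dvdr // coprimen2.
(* A multiple of L that is at most L is 0 or L: no step or every step is +1. *)
have [P0|Pgt] := posnP #|P|.
  right=> i; case: (step i) => // /eqP Pi.
  by move/card0_eq/(_ i): P0; rewrite unfold_in /P Pi.
left=> i; apply/eqP; have /eqP PT : #|P| == #|'I_L|.
  by rewrite eqn_leq max_card card_ord dvdn_leq.
by have /(_ i) := subset_cardP PT (subset_predT _); rewrite inE unfold_in.
Qed.

Variable M : nat -> 'I_L -> 'I_L -> R.
Implicit Types (a b : 'I_L * 'I_L) (phi : vmap).

(** A vertex is a pair (layer, position in the layer). The weight is directed; an undirected edge
    will receive the sum over its two orientations. *)
Definition layer_wt a b : R := if b.1 == a.1 + 1 then M a.1 a.2 b.2 else 0.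

Lemma layer_wt_neq0 a b : layer_wt a b != 0 -> b.1 = a.1 + 1.
Proof. by rewrite /layer_wt; case: (b.1 =P _) => // _; rewrite eqxx. Qed.

(** A nonzero weight both ways would give 2 = 0 modulo L, but L is at least 3. *)
Lemma layer_wt_antisym a b : b.1 = a.1 + 1 -> layer_wt b a = 0.
Proof.
move=> ab; rewrite /layer_wt ab; case: eqP => // /eqP.
rewrite -addrA -subr_eq0 opprD addNKr oppr_eq0 -[1 + 1]/2%:R Zp_nat.
by move/eqP/(congr1 val); rewrite /= modn_small.
Qed.

(** No mixed term of the expansion survives. If some step has neither orientation, all three
    products contain a zero factor; otherwise [closed_walk_oriented] applies, and antisymmetry
    removes the opposite summand from every factor. *)
Lemma prod_layer_orient phi :
  \prod_i (layer_wt (phi i) (phi (i + 1)) + layer_wt (phi (i + 1)) (phi i))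
  = \prod_i layer_wt (phi i) (phi (i + 1)) + \prod_i layer_wt (phi (i + 1)) (phi i).
Proof.
pose up i := (phi (i + 1)).1 == (phi i).1 + 1.
pose down i := (phi i).1 == (phi (i + 1)).1 + 1.
have up0 i : ~~ up i -> layer_wt (phi i) (phi (i + 1)) = 0.
  by apply: contraNeq => /layer_wt_neq0/eqP.
have down0 i : ~~ down i -> layer_wt (phi (i + 1)) (phi i) = 0.
  by apply: contraNeq => /layer_wt_neq0/eqP.
have prod0 (F : 'I_L -> R) i : F i = 0 -> \prod_i F i = 0.
  by move=> Fi; rewrite (bigD1 i) //= Fi mul0r.
have [stepP|/forallPn[i]] := boolP [forall i, up i || down i]; last first.
  rewrite negb_or => /andP[/up0 u0 /down0 d0].
  by rewrite !(prod0 _ i) ?u0 ?d0 ?addr0.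
have [|upP|downP] := @closed_walk_oriented (fun i => (phi i).1).
- by move=> i; case/orP: (forallP stepP i) => /eqP; [left|right].
- rewrite [X in _ + X](prod0 _ 0) ?layer_wt_antisym // addr0.
  by apply: eq_bigr => i _; rewrite [X in _ + X]layer_wt_antisym ?addr0.
- rewrite [X in _ = X + _](prod0 _ 0) ?layer_wt_antisym // add0r.
  by apply: eq_bigr => i _; rewrite [X in X + _]layer_wt_antisym ?add0r.
Qed.

Lemma sum_layer_rev :
  \sum_(phi : vmap) \prod_i layer_wt (phi (i + 1)) (phi i)
  = \sum_(phi : vmap) \prod_i layer_wt (phi i) (phi (i + 1)).
Proof.
pose rev phi := [ffun i => phi (- i)] : vmap.
have revK : involutive rev by move=> phi; apply/ffunP => i; rewrite !ffunE opprK.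
rewrite (reindex_inj (inv_inj revK)); apply: eq_bigr => phi _.
(* The reflection of the cycle by negation swaps the edge from i to i + 1 with the one from - i - 1
   to - i. *)
rewrite (reindex_inj (h := fun i => - i - 1)); last by move=> i j /addIr/oppr_inj.
by apply: eq_bigr => i _; rewrite !ffunE subrK opprK opprB opprK addrC.
Qed.

(** Rotating the cycle by c turns the condition into: vertex c lies in layer c. On maps with nonzero
    product this puts each vertex i in layer i, so that only the positions inside the layers remain
    to be summed over. *)
Lemma sum_layer_shift (c : 'I_L) :
  \sum_(phi : vmap | (phi 0).1 == c) \prod_i layer_wt (phi i) (phi (i + 1))
  = \sum_(psi : {ffun 'I_L -> 'I_L}) \prod_(i < L) M i (psi i) (psi (ordS i)).
Proof.
pose sh (d : 'I_L) phi := [ffun i => phi (i + d)] : vmap.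
have shK d : cancel (sh d) (sh (- d)).
  by move=> phi; apply/ffunP => i; rewrite !ffunE subrK.
rewrite (reindex_inj (can_inj (shK c))) /=.
transitivity (\sum_(phi : vmap | [forall i, (phi i).1 == i])
                 \prod_i layer_wt (phi i) (phi (i + 1))).
  rewrite big_mkcond [RHS]big_mkcond; apply: eq_bigr => phi _.
  rewrite ffunE add0r.
  have -> : \prod_i layer_wt (sh c phi i) (sh c phi (i + 1))
          = \prod_i layer_wt (phi i) (phi (i + 1)).
    rewrite [RHS](reindex_inj (h := fun i => i + c)); last exact: addIr.
    by apply: eq_bigr => i _; rewrite !ffunE addrAC.
  have [up|/forallPn[i ndi]] :=
    boolP [forall i, (phi (i + 1)).1 == (phi i).1 + 1]; last first.
    have -> : \prod_i layer_wt (phi i) (phi (i + 1)) = 0.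
      by rewrite (bigD1 i) //= /layer_wt (negPf ndi) mul0r.
    by rewrite !if_same.
  congr (if _ then _ else _); apply/eqP/forallP => [phic i|/(_ c)/eqP//].
  have := @Zp_step_succ (fun i => (phi i).1) (fun j => eqP (forallP up j)) c (i - c).
  by rewrite phic subrKC => /eqP.
pose h (psi : {ffun 'I_L -> 'I_L}) := [ffun i => (i, psi i)] : {ffun 'I_L -> _}.
rewrite (reindex h) /=; last first.
  exists (fun phi => [ffun i => (phi i).2]) => [psi _|phi /forallP phiP].
    by apply/ffunP => i; rewrite !ffunE.
  by apply/ffunP => i; rewrite !ffunE; case: (phi i) (phiP i) => x y /= /eqP ->.
apply: eq_big => [psi|psi _]; first by apply/forallP => i; rewrite ffunE.
by apply: eq_bigr => i _; rewrite !ffunE /layer_wt /= eqxx (@add_Zp_1 q.+3).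
Qed.

Lemma sum_layer_sym :
  \sum_(phi : vmap) \prod_i (layer_wt (phi i) (phi (i + 1)) + layer_wt (phi (i + 1)) (phi i))
  = (2 * L)%:R * \sum_a walk M a L a.
Proof.
rewrite (eq_bigr _ (fun phi _ => prod_layer_orient phi)) big_split /=.
rewrite sum_layer_rev -mulr2n (partition_big (fun phi => (phi 0).1) predT) //=.
rewrite (eq_bigr _ (fun c _ => sum_layer_shift c)) sum_cycles.
by rewrite sumr_const card_ord -mulrnA -[LHS]mulr_natl mulnC.
Qed.

End LayeredCycle.

(** * The homomorphism polynomial of a cycle into a complete graph *)

Section CycleHomPoly.
Variables (F : fieldType) (q N : nat).
Local Notation L := q.+3.

Definition edge_var (a b : 'I_N) : {mpoly F[nvars (@complete_adj N)]} :=
  Yvar F (@complete_adj N) [set a; b].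

Lemma edge_mem (a b : 'I_N) : ([set a; b] \in edges (@complete_adj N)) = (a != b).
Proof.
rewrite inE; apply/existsP/idP => [[u /existsP[v /andP[uv /eqP ab]]]|ab].
  by have := cards2 a b; rewrite ab cards2 -/(complete_adj u v) uv; case: (a != b).
by exists a; apply/existsP; exists b; rewrite eqxx andbT.
Qed.

Lemma edge_var_X (a b : 'I_N) (ab : [set a; b] \in edges (@complete_adj N)) :
  edge_var a b = 'X_(enum_rank (Sub [set a; b] ab : edgeH (@complete_adj N))).
Proof. by rewrite /edge_var /Yvar insubT. Qed.

Lemma edge_var_loop a : edge_var a a = 0.
Proof. by rewrite /edge_var /Yvar insubN // edge_mem eqxx. Qed.

Definition cycle_edge (i : 'I_L) : {set 'I_L} := [set i; i + 1].

(** Two distinct indices with the same edge would be successors of each other, so 2 = 0 modulo L.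
    Injectivity turns the product over the set of edges into a product over indices. *)
Lemma cycle_edge_inj : injective cycle_edge.
Proof.
have two_neq0 : (1 + 1 : 'I_L) != 0.
  rewrite -[1 + 1]/2%:R Zp_nat; apply/eqP => /(congr1 val).
  by rewrite /= modn_small.
move=> i j eq_ij; have := set21 i (i + 1); have := set22 i (i + 1).
rewrite -!/(cycle_edge i) eq_ij !inE => /orP[/eqP ij|/eqP/addIr//].
case/orP=> /eqP // ij'; move: two_neq0.
by rewrite -(inj_eq (addrI j)) addrA -ij' ij addr0 eqxx.
Qed.

Lemma cycle_adjE (i j : 'I_L) : cycle_adj i j = (j == i + 1) || (i == j + 1).
Proof.
rewrite /cycle_adj !(@add_Zp_1 q.+3) -!val_eqE /=.
case: eqP => //= ->; apply/esym/negbTE; rewrite orbb.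
have := ltn_ord j; rewrite ltnS leq_eqVlt => /orP[/eqP->|lt_j].
  by rewrite modnn.
by rewrite modn_small ?ltnS // neq_ltn ltnSn.
Qed.

Lemma edges_cycle : edges (@cycle_adj L) = [set cycle_edge i | i : 'I_L].
Proof.
apply/setP => e; rewrite inE; apply/existsP/imsetP.
  case=> u /existsP[v]; rewrite cycle_adjE => /andP[uv /eqP->].
  by case/orP: uv => /eqP ->; [exists u | exists v; rewrite // setUC].
case=> i _ ->; exists i; apply/existsP; exists (i + 1).
by rewrite cycle_adjE !eqxx.
Qed.

(** A map that is not a homomorphism collapses some cycle edge to a loop, where [edge_var] is 0;
    hence the sum may run over all maps. *)
Lemma hom_poly_cycle :
  hom_poly F (@cycle_adj L) (@complete_adj N)
  = \sum_(phi : {ffun 'I_L -> 'I_N}) \prod_i edge_var (phi i) (phi (i + 1)).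
Proof.
rewrite /hom_poly big_mkcond; apply: eq_bigr => phi _.
case: ifP => [_|/negbT].
  rewrite edges_cycle big_imset /=; last by move=> i j _ _; apply: cycle_edge_inj.
  by apply: eq_bigr => i _; rewrite /cycle_edge imsetU1 imset_set1.
rewrite negb_forall => /existsP[u]; rewrite negb_forall => /existsP[v].
rewrite negb_imply cycle_adjE /complete_adj negbK => /andP[uv /eqP phi_uv].
have [i phi_i] : exists i, phi i = phi (i + 1).
  by case/orP: uv => /eqP uv; [exists u|exists v]; rewrite -uv.
by rewrite (bigD1 i) //= -phi_i edge_var_loop mul0r.
Qed.

End CycleHomPoly.

(** * Closure properties of polynomially bounded functions *)

Section PolynomialBounds.
Implicit Types f g : nat -> nat.

Lemma pbounded_le f g : (forall n, f n <= g n)%N -> pbounded g -> pbounded f.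
Proof. by move=> fg [c gP]; exists c => n; apply: leq_trans (fg n) (gP n). Qed.

Lemma pbounded_const k : pbounded (fun=> k).
Proof.
(* The exponent k works because k < 2 ^ k <= (n + 2) ^ k. *)
exists k => n; have := ltn_expl k (isT : 1 < 2)%N.
by move/ltnW/leq_trans; apply; case: k => // k; rewrite leq_exp2r ?leq_addl.
Qed.

Lemma pbounded_id : pbounded id.
Proof. by exists 1%N => n; rewrite leq_addr. Qed.

Lemma pbounded_mul f g :
  pbounded f -> pbounded g -> pbounded (fun n => f n * g n)%N.
Proof.
by move=> [c fP] [d gP]; exists (c + d)%N => n; rewrite expnD leq_mul.
Qed.

Lemma pbounded_add f g :
  pbounded f -> pbounded g -> pbounded (fun n => f n + g n)%N.
Proof.
move=> pf pg.
(* The sum is dominated by a product, so only adding 1 has to be treated by hand. *)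
apply: (@pbounded_le _ (fun n => (f n + 1) * (g n + 1))%N) => [n|].
  by rewrite mulnDl mulnDr; lia.
have pS h : pbounded h -> pbounded (fun n => h n + 1)%N.
  case=> c hP; exists c.+1 => n; have := hP n.
  by have := expn_gt0 (n + 2) c; rewrite expnS; nia.
by apply: pbounded_mul; apply: pS.
Qed.

Lemma pbounded_exp f k : pbounded f -> pbounded (fun n => f n ^ k)%N.
Proof.
move=> pf; elim: k => [|k IHk]; first exact: pbounded_const.
by apply: pbounded_le (pbounded_mul pf IHk) => n; rewrite expnS.
Qed.

End PolynomialBounds.

(** * Skew circuits for iterated matrix products *)

Section SkewCircuits.
Variables (F : fieldType) (n : nat).
Implicit Types (gs h : seq (gate F n)) (p c : {mpoly F[n]}).

(** These are both the values of leaves and the values that a projection may substitute, so one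
    predicate serves membership and hardness. *)
Definition simple p := (exists a : F, p = a%:MP) \/ (exists j : 'I_n, p = 'X_j).

Lemma simpleP p :
  simple p -> exists2 o : operand F n, is_leaf o & forall vals, eval_operand vals o = p.
Proof. by case=> -[x ->]; [exists (OConst _ x) | exists (OVar _ x)]. Qed.

Lemma simple_const (a : F) : simple a%:MP. Proof. by left; exists a. Qed.
Lemma simple0 : simple 0. Proof. by rewrite -mpolyC0; apply: simple_const. Qed.
Lemma simple1 : simple 1. Proof. by rewrite -mpolyC1; apply: simple_const. Qed.

Lemma gate_values_rcons gs g :
  gate_values (rcons gs g) = rcons (gate_values gs) (eval_gate (gate_values gs) g).
Proof. by rewrite /gate_values foldl_rcons. Qed.

Lemma size_gate_values gs : size (gate_values gs) = size gs.
Proof.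
by elim/last_ind: gs => // gs g IH; rewrite gate_values_rcons !size_rcons IH.
Qed.

(** The bound on j excludes dangling references, whose value could change from 0 once more gates are
    appended; this gives [avail_cat]. *)
Definition avail gs p : Prop := exists2 o : operand F n,
  (if o is OGate j then j < size gs else true)%N & eval_operand (gate_values gs) o = p.

Lemma avail_simple gs p : simple p -> avail gs p.
Proof. by case/simpleP=> o leaf_o oP; exists o; rewrite ?oP //; case: o leaf_o {oP}. Qed.

Lemma avail_rcons gs g : avail (rcons gs g) (eval_gate (gate_values gs) g).
Proof.
exists (OGate _ _ (size gs)); rewrite ?size_rcons //=.
by rewrite gate_values_rcons nth_rcons size_gate_values ltnn eqxx.
Qed.

Lemma avail_cat gs h p : avail gs p -> avail (gs ++ h) p.
Proof.
elim/last_ind: h => [|h g IH]; first by rewrite cats0.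
move=> /IH[o ok_o op]; rewrite -rcons_cat; exists o.
  by case: o ok_o {op} => // j; rewrite size_rcons => /ltnW.
rewrite -{}op; case: o ok_o => //= j lt_j.
by rewrite gate_values_rcons nth_rcons size_gate_values lt_j.
Qed.

(** Circuit construction with a gate budget k; [reach_ret] and [reach_bind] compose constructions
    and add their budgets. *)
Definition reach k gs (P : seq (gate F n) -> Prop) : Prop :=
  exists h, [/\ all (@skew_gate F n) h, (size h <= k)%N & P (gs ++ h)].

Lemma reach_ret k gs (P : seq (gate F n) -> Prop) : P gs -> reach k gs P.
Proof. by move=> Pgs; exists [::]; rewrite cats0. Qed.

Lemma reach_bind k l gs (P Q : seq (gate F n) -> Prop) :
  reach k gs P -> (forall h, P (gs ++ h) -> reach l (gs ++ h) Q) ->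
  reach (k + l) gs Q.
Proof.
move=> [h [h_skew h_size Ph]] /(_ h Ph)[h' [h'_skew h'_size Qh]].
by exists (h ++ h'); rewrite all_cat h_skew size_cat leq_add // catA.
Qed.

(** One multiplication and one addition; the former is skew because c is a leaf. *)
Lemma reach_mulacc gs r p c :
  avail gs r -> avail gs p -> simple c -> reach 2 gs (fun gs' => avail gs' (r + p * c)).
Proof.
move=> avr [op op_ok opP] /simpleP[oc oc_leaf ocP].
have /(avail_cat [:: GMul op oc])[or or_ok orP] := avr.
exists [:: GMul op oc; GAdd or (OGate _ _ (size gs))]; split=> //=.
  by rewrite oc_leaf orbT.
rewrite cats1 in orP; set g := GAdd _ _.
have -> : gs ++ [:: GMul op oc; g] = rcons (rcons gs (GMul op oc)) g.
  by rewrite -!cats1 -catA.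
have := avail_rcons (rcons gs (GMul op oc)) g.
rewrite /= orP gate_values_rcons nth_rcons size_gate_values ltnn eqxx /=.
by rewrite opP ocP.
Qed.

Lemma reach_all (T : eqType) (s : seq T) k gs (Q : T -> seq (gate F n) -> Prop) :
  (forall x gs' h, Q x gs' -> Q x (gs' ++ h)) ->
  (forall h x, reach k (gs ++ h) (Q x)) ->
  reach (size s * k) gs (fun gs' => forall x, x \in s -> Q x gs').
Proof.
move=> Qmono reachQ; elim: s => [|x s IHs]; first exact: reach_ret.
rewrite /= mulSn addnC; apply: reach_bind IHs _ => h Qs.
have [h' [h'_skew h'_size Qx]] := reachQ h x.
exists h'; split=> // y; rewrite inE => /predU1P[-> //|/Qs].
exact: Qmono.
Qed.

Lemma reach_dot (T : Type) (s : seq T) (p c : T -> {mpoly F[n]}) gs :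
  (forall x, simple (c x)) -> (forall x, avail gs (p x)) ->
  reach (size s * 2) gs (fun gs' => avail gs' (\sum_(x <- s) p x * c x)).
Proof.
move=> c_simple av_p; elim: s => [|x s IHs].
  by apply: reach_ret; rewrite big_nil; apply/avail_simple/simple0.
rewrite /= mulSn addnC; apply: reach_bind IHs _ => h av_s.
by rewrite big_cons addrC; apply: reach_mulacc => //; apply: avail_cat.
Qed.

(** Each of the t steps computes #|W| ^ 2 entries, each of them a sum of #|W| products at 2 gates
    apiece. *)
Lemma reach_walk (W : finType) (M : nat -> W -> W -> {mpoly F[n]}) t gs :
  (forall i a b, simple (M i a b)) ->
  reach (t * (#|W| ^ 2 * (#|W| * 2))) gs
    (fun gs' => forall a b, avail gs' (walk M a t b)).
Proof.
move=> M_simple; elim: t => [|t IHt].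
  apply: reach_ret => a b; apply: avail_simple.
  by rewrite /=; case: (a == b); [apply: simple1 | apply: simple0].
rewrite mulSn addnC; apply: reach_bind IHt _ => h av_t.
have [||h' [skew_h' size_h' Ph']] := @reach_all _ (enum {:W * W}) (#|W| * 2) (gs ++ h)
  (fun x gs' => avail gs' (walk M x.1 t.+1 x.2)).
- by move=> x gs' h' /avail_cat; apply.
- move=> h' [a b] /=.
  have := @reach_dot _ (index_enum W) (walk M a t) (M t ^~ b) ((gs ++ h) ++ h').
  have -> : size (index_enum W) = #|W| by rewrite -sum1_size sum1_card.
  by apply=> // x; apply: avail_cat.
exists h'; split=> //; first by rewrite -cardE card_prod in size_h'.
by move=> a b; apply: (Ph' (a, b)); rewrite mem_enum.
Qed.

(* Importing all_algebra hides [skew] behind a notation for forms, hence [Defs.skew]. *)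
Lemma skew_circuit_cycles (W : finType) (M : nat -> W -> W -> {mpoly F[n]}) (L : nat) :
  (forall i a b, simple (M i a b)) ->
  exists C : circuit F n, [/\ Defs.skew C,
    (circuit_size C <= (L * (#|W| ^ 2 * (#|W| * 2)) + #|W| * 2).+1)%N &
    circuit_poly C = \sum_a walk M a L a].
Proof.
move=> M_simple.
have [|h [skew_h size_h [o _ oP]]] := @reach_bind _ (#|W| * 2) [::] _
  (fun gs' => avail gs' (\sum_a walk M a L a)) (@reach_walk W M L [::] M_simple).
  (* The trace is the dot product of the diagonal with the all-ones vector. *)
  move=> h av_h; have := @reach_dot _ (index_enum W) (fun a => walk M a L a)
    (fun=> 1) h (fun=> simple1) (fun a => av_h a a).
  have -> : size (index_enum W) = #|W| by rewrite -sum1_size sum1_card.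
  by under eq_bigr do rewrite mulr1.
by exists (Circuit h o).
Qed.

End SkewCircuits.

(** * Membership of the family in VBP *)

Section Membership.
Variable F : fieldType.

Lemma edge_var_simple N (a b : 'I_N) : simple (edge_var F a b).
Proof.
rewrite /edge_var /Yvar; case: insub => [e|]; last exact: simple0.
by right; exists (enum_rank e).
Qed.

Lemma fk_walk n :
  fk F n = \sum_a walk (fun=> @edge_var F (compl_size n)) a (cyc_len n) a.
Proof.
have [q Lq] : exists q, cyc_len n = q.+3 by exists (2 * n)%N; rewrite /cyc_len; lia.
rewrite /fk Lq hom_poly_cycle -sum_cycles; apply: eq_bigr => phi _.
by apply: eq_bigr => i _; rewrite (@add_Zp_1 q.+3).
Qed.

Lemma msize_simple n (p : {mpoly F[n]}) : simple p -> (msize p <= 2)%N.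
Proof.
case=> -[x ->]; first by rewrite mmeasureC; case: (x != 0).
by rewrite msizeX mdeg1.
Qed.

Lemma msize_walk n (W : finType) (M : nat -> W -> W -> {mpoly F[n]}) a t b :
  (forall i c d, simple (M i c d)) -> (msize (walk M a t b) <= (3 * t).+1)%N.
Proof.
move=> M_simple; elim: t b => [|t IHt] b /=.
  by case: (a == b); rewrite ?msize1 ?mmeasure0.
apply: leq_trans (mmeasure_sum _ _ _ _) _; apply/bigmax_leqP => c _.
apply: leq_trans (msizeM_le _ _) _; rewrite mulnS addSn addnC !ltnS.
by rewrite -addnS leq_add // msize_simple.
Qed.

Lemma fk_vars_le n : (fk_vars n <= compl_size n ^ 2)%N.
Proof.
rewrite /fk_vars /nvars card_sig -[compl_size n in X in (_ <= X)%N]card_ord.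
rewrite -mulnn -card_prod.
apply: leq_trans (leq_imset_card (fun p => [set p.1; p.2]) _).
apply/subset_leq_card/subsetP => e; rewrite inE => /existsP[a /existsP[b /andP[_ /eqP->]]].
by apply/imsetP; exists (a, b).
Qed.

Lemma pbounded_cyc_len : pbounded cyc_len.
Proof.
apply: (@pbounded_le _ (fun n => 2 * n + 3)%N) => [n|]; first by rewrite /cyc_len; lia.
by apply: pbounded_add (pbounded_mul _ pbounded_id) _; apply: pbounded_const.
Qed.

Lemma fk_in_VBP : in_VBP (@fk F).
Proof.
have pN : pbounded compl_size by apply: pbounded_exp pbounded_cyc_len.
have pN2 : pbounded (fun n => compl_size n * 2)%N by apply: pbounded_mul pN (pbounded_const 2).
split; first split.
- exact: pbounded_le fk_vars_le (pbounded_exp 2 pN).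
- apply: (@pbounded_le _ (fun n => 3 * cyc_len n + 1)%N); last first.
    exact: pbounded_add (pbounded_mul (pbounded_const 3) pbounded_cyc_len) (pbounded_const 1).
  move=> n; rewrite fk_walk addn1.
  apply: leq_trans (mmeasure_sum _ _ _ _) _; apply/bigmax_leqP => a _.
  by apply: msize_walk => *; apply: edge_var_simple.
exists (fun n => cyc_len n * (compl_size n ^ 2 * (compl_size n * 2)) +
                 compl_size n * 2 + 1)%N; split.
  have pLN := pbounded_mul pbounded_cyc_len (pbounded_mul (pbounded_exp 2 pN) pN2).
  exact: pbounded_add (pbounded_add pLN pN2) (pbounded_const 1).
move=> n; have [C [skewC sizeC polyC]] :=
  @skew_circuit_cycles F _ _ (fun=> @edge_var F (compl_size n)) (cyc_len n)
    (fun _ a b => edge_var_simple a b).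
exists C; split=> //; split; last by rewrite polyC fk_walk.
by rewrite card_ord in sizeC; rewrite addn1.
Qed.

End Membership.

(** * Compiling skew circuits to register programs, that is, to products of elementary matrices *)

Section RegisterPrograms.
Variables (F : fieldType) (n : nat).
Local Notation poly := {mpoly F[n]}.
Implicit Types (gs : seq (gate F n)) (o : operand F n) (st : nat -> poly).

(* The instruction (d, e, c) adds c times register e to register d. *)
Local Notation instr := (nat * nat * poly)%type.

Definition exec st (i : instr) : nat -> poly :=
  fun r => if r == i.1.1 then st r + i.2 * st i.1.2 else st r.

(** The source lies strictly below the target, so no register is added to itself and the matrix of
    the instruction keeps a unit diagonal. *)
Definition valid_instr w (i : instr) : Prop :=
  [/\ (i.1.2 < i.1.1)%N, (i.1.1 < w)%N & simple i.2].

Definition instr_mx (i : instr) (a b : nat) : poly :=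
  if (a == i.1.2) && (b == i.1.1) then i.2 else (a == b)%:R.

(** Its matrix is the identity; as the default of [nth] it pads a program to any length. *)
Definition nop : instr := (1%N, 0%N, 0).

Definition init : nat -> poly := fun r => (r == 0%N)%:R.

Lemma sum_instr_mx w st i (b : 'I_w) :
  valid_instr w i -> \sum_(a < w) st a * instr_mx i a b = exec st i b.
Proof.
case: i => [[d e] c] [/= lt_ed lt_dw _].
have sum_delta (r : nat) (x : poly) : (r < w)%N ->
    \sum_(a < w) st a * (if a == r :> nat then x else 0) = st r * x.
  move=> lt_rw; rewrite (bigD1 (Ordinal lt_rw)) //= eqxx big1 ?addr0 // => a.
  by rewrite -val_eqE /= => /negPf ->; rewrite mulr0.
(* The matrix splits as the identity plus c E_(e,d), which do not overlap since e < d. *)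
transitivity (\sum_(a < w) (st a * (if a == b :> nat then 1 else 0)
   + st a * (if a == e :> nat then (if b == d :> nat then c else 0) else 0))).
  apply: eq_bigr => a _; rewrite -mulrDr /instr_mx /=; congr (_ * _).
  have [-> /=|] := eqVneq (a : nat) e; last first.
    by move=> _ /=; rewrite addr0; case: eqP.
  have [->|] := eqVneq (b : nat) d; first by rewrite (ltn_eqF lt_ed) add0r.
  by move=> _ /=; rewrite addr0; case: eqP.
rewrite big_split /= !sum_delta //; last exact: ltn_trans lt_dw.
rewrite mulr1 /exec /=; case: eqP => _; first by rewrite mulrC.
by rewrite mulr0 addr0.
Qed.

(** Row 0 of the matrix product is the initial register vector pushed through the program, and the
    padding by [nop] leaves it unchanged. *)
Lemma walk_exec w prog (a b : 'I_w) t :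
  (forall i, i \in prog -> valid_instr w i) -> a = 0%N :> nat ->
  walk (fun j (x y : 'I_w) => instr_mx (nth nop prog j) x y) a t b
  = foldl exec init (take t prog) b.
Proof.
move=> prog_ok a0; elim: t b => [|t IHt] b.
  by rewrite take0 /= /init -val_eqE /= a0 eq_sym.
rewrite /=; under eq_bigr do rewrite IHt.
have [lt_t|ge_t] := ltnP t (size prog).
  rewrite (take_nth nop) // foldl_rcons sum_instr_mx //.
  exact/prog_ok/mem_nth.
rewrite !take_oversize ?nth_default //; last exact: leqW.
(* For w = 1 the target of [nop] is out of range, so [sum_instr_mx] cannot be used here and the
   identity matrix is summed directly. *)
rewrite (bigD1 b) //= /instr_mx big1 => [|c].
  by rewrite eqxx /nop /=; case: (b : nat) => [|[]] *; rewrite mulr1 addr0.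
rewrite -val_eqE /= => /negPf ->.
by case: ifP; rewrite mulr0.
Qed.

(* Register 0 holds the constant 1 and register 2j + 2 the value of gate j. *)
Definition holds gs st : Prop :=
  st 0%N = 1 /\
  forall j, (j < size gs)%N -> st (2 * j + 2)%N = nth 0 (gate_values gs) j.

(** A leaf is loaded as a multiple of register 0, a gate as 1 times its register, and a dangling
    reference as 0. The bound puts d above every occupied register. *)
Lemma load_instr gs d o : (2 * size gs < d)%N ->
  exists2 i, valid_instr d.+1 i & forall st, holds gs st -> forall r,
    exec st i r = if r == d then st d + eval_operand (gate_values gs) o else st r.
Proof.
move=> lt_d; have d_gt0 : (0 < d)%N by apply: leq_ltn_trans lt_d.
have leaf_case : (exists2 c, simple c & eval_operand (gate_values gs) o = c) ->
  exists2 i, valid_instr d.+1 i & forall st, holds gs st -> forall r,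
    exec st i r = if r == d then st d + eval_operand (gate_values gs) o else st r.
  case=> c c_simple ->; exists (d, 0%N, c) => // st [st0 _] r.
  by rewrite /exec /=; case: eqP => // ->; rewrite st0 mulr1.
case: o leaf_case => [x|x|j] leaf_case.
- by apply: leaf_case; exists 'X_x => //; right; exists x.
- by apply: leaf_case; exists x%:MP => //; left; exists x.
have [lt_j|ge_j] := ltnP j (size gs); last first.
  by apply: leaf_case; exists 0; [apply: simple0|rewrite /= nth_default ?size_gate_values].
exists (d, (2 * j + 2)%N, 1).
  by split=> //=; [lia|apply: simple1].
move=> st [_ st_gate] r; rewrite /exec /=; case: eqP => // ->.
by rewrite mul1r st_gate.
Qed.

Lemma holds_ext gs st st' : holds gs st ->
  (forall r, (r <= 2 * size gs)%N -> st' r = st r) -> holds gs st'.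
Proof.
move=> [st0 st_gate] st'P; split=> [|j lt_j]; first by rewrite st'P.
by rewrite st'P ?st_gate //; lia.
Qed.

Lemma holds_rcons gs g st : holds gs st ->
  st (2 * size gs + 2)%N = eval_gate (gate_values gs) g -> holds (rcons gs g) st.
Proof.
move=> [st0 st_gate] st_last; split=> // j.
rewrite size_rcons ltnS gate_values_rcons nth_rcons size_gate_values leq_eqVlt.
case/predU1P=> [->|lt_j]; first by rewrite ltnn eqxx.
by rewrite lt_j st_gate.
Qed.

(** With k gates done, an addition loads both operands into register 2k + 2. A product loads the
    operand opposite the leaf into the scratch register 2k + 1 and adds the leaf times it to
    register 2k + 2. Fresh registers are 0, so that adding to them acts as assignment. *)
Lemma compile_gate gs g st : skew_gate g -> holds gs st ->
  (forall r, (2 * size gs < r)%N -> st r = 0) ->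
  exists i j, [/\ valid_instr (2 * size gs + 3) i, valid_instr (2 * size gs + 3) j,
    holds (rcons gs g) (exec (exec st i) j) &
    forall r, (2 * (size gs).+1 < r)%N -> exec (exec st i) j r = 0].
Proof.
set k := size gs => g_skew gs_st st0.
have valid_w d i : (d < 2 * k + 3)%N -> valid_instr d.+1 i -> valid_instr (2 * k + 3) i.
  by move=> lt_d [? lt_i ?]; split=> //; apply: leq_trans lt_i _.
have mul_leaf a b : is_leaf a -> exists i j,
    [/\ valid_instr (2 * k + 3) i, valid_instr (2 * k + 3) j,
    holds gs (exec (exec st i) j),
    exec (exec st i) j (2 * k + 2)%N =
      eval_operand (gate_values gs) a * eval_operand (gate_values gs) b &
    forall r, (2 * k.+1 < r)%N -> exec (exec st i) j r = 0].
  move=> a_leaf; have [|i i_ok iP] := @load_instr gs (2 * k + 1) b; first by rewrite addn1.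
  pose j : instr := ((2 * k + 2)%N, (2 * k + 1)%N, eval_operand (gate_values gs) a).
  have jP st' r : exec st' j r = if r == (2 * k + 2)%N
    then st' r + eval_operand (gate_values gs) a * st' (2 * k + 1)%N else st' r by [].
  exists i, j; split.
  - by apply: valid_w i_ok; lia.
  - split=> /=; [lia|lia|].
    by case: a a_leaf {j jP} => //= x _; [right; exists x|left; exists x].
  - apply: (holds_ext gs_st) => r le_r; rewrite jP iP //.
    by rewrite !ifN //; apply/eqP; lia.
  - rewrite jP eqxx !iP // eqxx ifN; last by apply/eqP; lia.
    by rewrite !st0 ?add0r //; lia.
  - move=> r lt_r; rewrite jP !iP //.
    by rewrite !ifN ?st0 //; try apply/eqP; lia.
case: g g_skew => [a b _|a b /orP[a_leaf|b_leaf]].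
- have [|i i_ok iP] := @load_instr gs (2 * k + 2) a; first by lia.
  have [|j j_ok jP] := @load_instr gs (2 * k + 2) b; first by lia.
  have gs_i : holds gs (exec st i).
    apply: (holds_ext gs_st) => r le_r; rewrite iP // ifN //.
    by apply/eqP; lia.
  exists i, j; split.
  + by apply: valid_w i_ok; lia.
  + by apply: valid_w j_ok; lia.
  + apply: holds_rcons; last by rewrite jP // eqxx iP // eqxx st0 ?add0r //; lia.
    apply: (holds_ext gs_i) => r le_r; rewrite jP // ifN //.
    by apply/eqP; lia.
  + move=> r lt_r; rewrite jP // !iP // !ifN ?st0 //; try apply/eqP; lia.
- have [i [j [i_ok j_ok ij_gs ij_val ij0]]] := mul_leaf a b a_leaf.
  by exists i, j; split=> //; apply: holds_rcons.
- have [i [j [i_ok j_ok ij_gs ij_val ij0]]] := mul_leaf b a b_leaf.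
  by exists i, j; split=> //; apply: holds_rcons; rewrite // ij_val mulrC.
Qed.

Lemma compile_gates gs : all (@skew_gate F n) gs -> exists prog,
  [/\ size prog = (2 * size gs)%N,
      forall i, i \in prog -> valid_instr (2 * size gs + 1) i,
      holds gs (foldl exec init prog) &
      forall r, (2 * size gs < r)%N -> foldl exec init prog r = 0].
Proof.
elim/last_ind: gs => [_|gs g IHgs].
  by exists [::]; split=> // -[|r].
rewrite all_rcons => /andP[g_skew /IHgs[prog [size_prog prog_ok prog_gs prog0]]].
have [i [j [i_ok j_ok ij_gs ij0]]] := compile_gate g_skew prog_gs prog0.
exists (rcons (rcons prog i) j); rewrite !size_rcons !foldl_rcons; split=> //.
  by rewrite size_prog mulnS.
have -> : (2 * (size gs).+1 + 1 = 2 * size gs + 3)%N by lia.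
move=> x; rewrite mem_rcons inE mem_rcons inE.
case/predU1P=> [->|/predU1P[->|/prog_ok[? lt_x ?]]] //.
by split=> //; lia.
Qed.

Lemma compile_circuit (C : circuit F n) : Defs.skew C -> exists prog,
  [/\ size prog = (2 * size (gates C) + 1)%N,
      forall i, i \in prog -> valid_instr (2 * size (gates C) + 2) i &
      foldl exec init prog (2 * size (gates C) + 1)%N = circuit_poly C].
Proof.
case: C => gs o; rewrite /Defs.skew /circuit_poly /= => gs_skew.
have [prog [size_prog prog_ok prog_gs prog0]] := compile_gates gs_skew.
(* One further instruction loads the output operand into the first register that is still 0. *)
have [|i [lt_i1 lt_i2 i_simple] iP] := @load_instr gs (2 * size gs + 1) o.
  by rewrite addn1.
exists (rcons prog i); rewrite size_rcons size_prog; split; first by lia.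
  by move=> x; rewrite mem_rcons inE => /predU1P[->|/prog_ok[? ? ?]]; split=> //; lia.
by rewrite foldl_rcons iP // eqxx prog0 ?add0r ?addn1.
Qed.

End RegisterPrograms.

(** * Projections obtained by substituting edge weights *)

Lemma set2_eq (T : finType) (a b c d : T) :
  [set a; b] = [set c; d] -> (a = c /\ b = d) \/ (a = d /\ b = c).
Proof.
move=> eq_set.
have : a \in [set c; d] by rewrite -eq_set set21.
have : b \in [set c; d] by rewrite -eq_set set22.
have : c \in [set a; b] by rewrite eq_set set21.
have : d \in [set a; b] by rewrite eq_set set22.
rewrite !in_set2 => /orP[]/eqP-> /orP[]/eqP-> /orP[]/eqP? /orP[]/eqP?; subst; tauto.
Qed.

Section Projection.
Variables (F : fieldType) (m : nat).

Lemma projection_of_edge_subst N (S : 'I_N -> 'I_N -> {mpoly F[m]}) :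
  (forall a b, simple (S a b)) -> (forall a b, S a b = S b a) ->
  (forall a, S a a = 0) ->
  exists s : (nvars (@complete_adj N)).-tuple {mpoly F[m]},
    (forall i, simple (tnth s i)) /\
    (forall a b, edge_var F a b \mPo s = S a b).
Proof.
move=> S_simple S_sym S_diag.
(* An edge is an unordered pair; the symmetry of S makes the choice of its ordering immaterial. *)
pose val_edge (e : {set 'I_N}) :=
  if [pick p : 'I_N * 'I_N | e == [set p.1; p.2]] is Some p then S p.1 p.2 else 0.
exists [tuple val_edge (val (enum_val i)) | i < _]; split=> [i|a b].
  rewrite tnth_mktuple /val_edge; case: pickP => [p _|_] //; exact: simple0.
have [->|neq_ab] := eqVneq a b; first by rewrite edge_var_loop comp_mpoly0 S_diag.
have ab : [set a; b] \in edges (@complete_adj N) by rewrite edge_mem.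
rewrite (edge_var_X F ab) comp_mpolyXU -tnth_nth tnth_mktuple enum_rankK /=.
rewrite /val_edge; case: pickP => [p /eqP/set2_eq[] [-> ->] //|/(_ (a, b))].
by rewrite eqxx.
Qed.

Lemma projection_hom_poly_cycle L N (M : nat -> 'I_L -> 'I_L -> {mpoly F[m]}) :
  (2 < L)%N -> odd L -> N = (L ^ 2)%N -> (forall i a b, simple (M i a b)) ->
  projection_of ((2 * L)%:R * \sum_a walk M a L a)
                (hom_poly F (@cycle_adj L) (@complete_adj N)).
Proof.
case: L M => [|[|[|q]]] // M _ oddL defN M_simple.
have cardN : #|{: 'I_q.+3 * 'I_q.+3}| = N by rewrite card_prod card_ord defN mulnn.
pose h (x : 'I_N) : 'I_q.+3 * 'I_q.+3 := enum_val (cast_ord (esym cardN) x).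
pose h' (y : 'I_q.+3 * 'I_q.+3) : 'I_N := cast_ord cardN (enum_rank y).
have hK : cancel h h' by move=> x; rewrite /h /h' enum_valK cast_ordKV.
have h'K : cancel h' h by move=> y; rewrite /h /h' cast_ordK enum_rankK.
pose S a b := layer_wt M (h a) (h b) + layer_wt M (h b) (h a).
have wt_simple a b : simple (layer_wt M a b).
  by rewrite /layer_wt; case: ifP => // _; apply: simple0.
have wt_diag a : layer_wt M a a = 0.
  have [//|wt_neq0] := eqVneq (layer_wt M a a) 0.
  exact: layer_wt_antisym (layer_wt_neq0 wt_neq0).
have [|||s [s_simple sP]] := @projection_of_edge_subst N S.
(* At most one orientation has nonzero weight, so the sum of the two is still a constant or a
   variable. *)
- move=> a b; rewrite /S.
  have [->|/layer_wt_neq0/layer_wt_antisym->] := eqVneq (layer_wt M (h a) (h b)) 0.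
    by rewrite add0r.
  by rewrite addr0.
- by move=> a b; rewrite /S addrC.
- by move=> a; rewrite /S wt_diag addr0.
exists s; split=> //.
rewrite hom_poly_cycle -(sum_layer_sym oddL) raddf_sum /=.
rewrite (reindex (fun phi : {ffun 'I_q.+3 -> 'I_N} => [ffun i => h (phi i)])) /=.
  apply: eq_bigr => phi _; rewrite rmorph_prod /=; apply: eq_bigr => i _.
  by rewrite sP !ffunE.
exists (fun psi => [ffun i => h' (psi i)]) => phi _; apply/ffunP => i;
  by rewrite !ffunE ?hK ?h'K.
Qed.

Lemma projection_circuit L N (C : circuit F m) :
  odd L -> N = (L ^ 2)%N -> (2 * (size (gates C)).+1 < L)%N -> Defs.skew C ->
  (2 * L)%:R != 0 :> F ->
  projection_of (circuit_poly C) (hom_poly F (@cycle_adj L) (@complete_adj N)).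
Proof.
move=> oddL defN lt_L C_skew L_neq0; set k := size (gates C) in lt_L *.
have [prog [size_prog prog_ok progP]] := compile_circuit C_skew.
rewrite -/k in size_prog prog_ok progP.
case: L => // l in oddL defN lt_L L_neq0 *.
(* The hypothesis 2k + 2 < L makes room for the 2k + 2 registers in a layer and for the 2k + 1
   instructions among the first l = L - 1 matrices. *)
have out_lt : (2 * k + 1 < l.+1)%N by lia.
pose out := Ordinal out_lt; pose alpha : F := (2 * l.+1)%:R^-1.
(* The last matrix has a single nonzero entry, from the output register back to register 0. The
   trace thus reads off the output of the run started in register 0, scaled by the inverse of 2L. *)
pose M j (a b : 'I_l.+1) : {mpoly F[m]} :=
  if j == l then if (a == out) && (b == ord0) then alpha%:MP else 0
  else instr_mx (nth (nop F m) prog j) a b.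
have M_simple j a b : simple (M j a b).
  rewrite /M; case: ifP => _.
    by case: ifP => _; [apply: simple_const | apply: simple0].
  rewrite /instr_mx; case: ifP => _; last first.
    by case: (_ == _); [apply: simple1 | apply: simple0].
  have [lt_j|ge_j] := ltnP j (size prog); last by rewrite nth_default //; apply: simple0.
  by case: (prog_ok _ (mem_nth (nop F m) lt_j)).
suff -> : circuit_poly C = (2 * l.+1)%:R * \sum_a walk M a l.+1 a.
  by apply: projection_hom_poly_cycle => //; lia.
have walkM t b : (t <= l)%N -> walk M ord0 t b = foldl (@exec F m) (init F m) (take t prog) b.
  move=> le_t; rewrite -(@walk_exec _ _ l.+1 prog ord0) => // [|i /prog_ok[? ? ?]]; last first.
    by split=> //; lia.
  elim: t b le_t => //= t IHt b lt_t; apply: eq_bigr => c _.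
  by rewrite IHt ?(ltnW lt_t) // /M ltn_eqF.
have -> : \sum_a walk M a l.+1 a = walk M ord0 l out * alpha%:MP.
  rewrite (bigD1 ord0) //= [X in _ + X]big1 => [|a a_neq0]; last first.
    by apply: big1 => c _; rewrite /M eqxx (negPf a_neq0) andbF mulr0.
  rewrite addr0 (bigD1 out) //= {2}/M !eqxx big1 ?addr0 // => c c_neq.
  by rewrite {2}/M eqxx (negPf c_neq) mulr0.
rewrite walkM // take_oversize; last by lia.
rewrite progP mulrC -mulrA -[_%:R](rmorph_nat (@mpolyC m F)) -mpolyCM.
by rewrite mulVf // mpolyC1 mulr1.
Qed.

End Projection.

(** * Completeness, by a choice of the cycle length *)

Theorem theorem6 (F : fieldType) (hF : (2 \notin [pchar F])%N) :
  VBP_complete (@fk F).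
Proof.
split=> [|v f [_ [s [pb_s circ]]]]; first exact: fk_in_VBP.
have two_neq0 : 2%:R != 0 :> F by move: hF; rewrite inE.
(* The length 2 s + 3 exceeds twice the circuit size; if it vanishes in F, the next odd length is
   taken instead. *)
pose t n := if (cyc_len (s n))%:R == 0 :> F then (s n).+1 else s n.
exists t; split.
  apply: (@pbounded_le _ (fun n => s n + 1)%N) => [n|]; last first.
    exact: pbounded_add pb_s (pbounded_const 1).
  by rewrite /t addn1; case: ifP.
move=> n; have [C [C_skew [C_size <-]]] := circ n.
have le_t : (s n <= t n)%N by rewrite /t; case: ifP.
apply: projection_circuit => //.
- by rewrite /cyc_len oddS oddM.
- by rewrite /circuit_size in C_size; rewrite /cyc_len; lia.
(* An odd prime cannot divide both 2 s + 3 and 2 s + 5. *)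
rewrite natrM mulf_neq0 // /t; case: ifP => [/eqP s0|/negbT //].
have -> : cyc_len (s n).+1 = (cyc_len (s n) + 2)%N by rewrite /cyc_len; lia.
by rewrite natrD s0 add0r.
Qed.
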